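(* Let $\phi''_F > 0$, $\phi''_{2F} < 0$, and suppose that $\phi''_F+8\phi''_{2F}>0$. Then the atomistic problem $$(L^a\mathbf{u}^a)_j=f_j\ \text{ for } j=-M+1,\dots,M-1,\qquad u^a_j=0\ \text{ for } j=-M,\,M,$$ and the force-based quasicontinuum approximation $$(L^{qcf}\mathbf{u}^{qcf})_j=f_j\ \text{ for } j=-N+1,\dots,N-1,\qquad u^{qcf}_j=u^a_j\ \text{ for } j=-N,\,N,$$ have unique solutions $\mathbf{u}^a\in\mathbb{R}^{2M+1}$ and $\mathbf{u}^{qcf}\in\mathbb{R}^{2N+1}$, and they satisfy the error estimate $$\big\|D(\mathbf{u}^a-\mathbf{u}^{qcf})\big\|_{\ell^\infty_\epsilon}\le 4\epsilon^2\,\frac{|\phi''_{2F}|\,\|D^3\mathbf{u}^a\|_{\ell^\infty_\epsilon(\widetilde{\mathcal{C}})}}{\phi''_F+8\phi''_{2F}},$$ where on the left-hand side $\mathbf{u}^a$ is restricted to the indices $-N,\dots,N$.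
   Context: Let $\phi''_F := \phi''(F)$ and $\phi''_{2F} := \phi''(2F)$ be real numbers, where $\phi$ is an interatomic pair potential and $F>0$ (only these two real numbers enter). Let $M, N, K$ be integers with $0<K<N-1$ and $N<M$, and $\epsilon=1/N$. Let forces $f_j\in\mathbb{R}$, $j=-M+1,\dots,M-1$, be given. Atomistic operator: for $\mathbf{v}\in\mathbb{R}^{2M+1}$ (indices $-M,\dots,M$), $$(L^a\mathbf{v})_j=\phi''_F\frac{-v_{j+1}+2v_j-v_{j-1}}{\epsilon^2}+\phi''_{2F}\,\frac{s_j}{\epsilon^2},$$ with $s_j=-v_{j+2}+2v_j-v_{j-2}$ for $-M+2\le j\le M-2$, $s_{-M+1}=-v_{-M+3}+v_{-M+1}$, and $s_{M-1}=v_{M-1}-v_{M-3}$. QCF operator: with $\mathcal{A}=\{-K,\dots,K\}$ and $\mathcal{C}=\{-N+1,\dots,N-1\}\setminus\mathcal{A}$, for $\mathbf{v}\in\mathbb{R}^{2N+1}$ (indices $-N,\dots,N$), $$(L^{qcf}\mathbf{v})_j = \phi''_F\frac{-v_{j+1}+2v_j-v_{j-1}}{\epsilon^2} + \phi''_{2F}\frac{-v_{j+2}+2v_j-v_{j-2}}{\epsilon^2}\quad (j\in\mathcal{A}),$$ $$(L^{qcf}\mathbf{v})_j = (\phi''_F+4\phi''_{2F})\frac{-v_{j+1}+2v_j-v_{j-1}}{\epsilon^2}\quad (j\in\mathcal{C}).$$ Notation: $Dv_j=(v_j-v_{j-1})/\epsilon$ (backward difference); $D^3v_j=\epsilon^{-2}(Dv_j-2Dv_{j-1}+Dv_{j-2})$;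 $\|\cdot\|_{\ell^\infty_\epsilon}$ is the maximum of absolute values over all indices of the vector (here $-N+1,\dots,N$ for $D(\mathbf{u}^a-\mathbf{u}^{qcf})$); $\widetilde{\mathcal{C}}=\{-N+2,\dots,-K+1\}\cup\{K+2,\dots,N+1\}$ and $\|D^3\mathbf{u}^a\|_{\ell^\infty_\epsilon(\widetilde{\mathcal{C}})}=\max_{j\in\widetilde{\mathcal{C}}}|D^3u^a_j|$. *)

(* Defs.v *)
From HB Require Import structures.
From mathcomp Require Import all_boot all_order all_algebra.
From mathcomp Require Import reals.

Set Implicit Arguments.
Unset Strict Implicit.
Unset Printing Implicit Defensive.

Import Order.TTheory GRing.Theory Num.Theory.

Local Open Scope ring_scope.

(* The space R^(2n+1) of vectors whose components carry the indices
   -n, ..., n; component j is stored at position j + n. *)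
Notation lvec R n := 'rV[R]_(n.*2.+1).

(* [entry v j] is v_j for -n <= j <= n; outside of this range it is a junk
   value, and no statement below reads it there. *)
Definition entry (R : Type) (n : nat) (v : lvec R n) (j : int) : R :=
  v ord0 (inord (absz (j + n%:Z))).

Definition irange (a b : int) : seq int :=
  if a <= b then [seq a + i%:Z | i <- iota 0 (absz (b - a)).+1] else [::].

Lemma mem_irange (a b j : int) : (j \in irange a b) = (a <= j <= b).
Proof.
rewrite /irange; case: leP => [le_ab | lt_ba]; last first.
  by apply/esym/negbTE/negP => /andP[aj jb]; move: (le_trans aj jb); rewrite leNgt lt_ba.
apply/mapP/andP => [[i] | [aj jb]].
  rewrite mem_iota add0n ltnS => /andP[_ lei] ->; split.
    by rewrite lerDl.
  by rewrite -lerBrDl -[b - a]gez0_abs ?subr_ge0 // lez_nat.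
exists (absz (j - a)); last by rewrite gez0_abs ?subr_ge0 // subrKC.
rewrite mem_iota add0n ltnS /= -lez_nat !gez0_abs ?subr_ge0 //.
by rewrite lerD2r.
Qed.

Section Operators.
Variable R : realType.
Implicit Types (phiF phi2F eps : R) (g : int -> R) (j : int).

(* The maximum over the indices in s; the unit 0 is harmless because absolute
   values are nonnegative. *)
Definition linf_norm (s : seq int) g : R := \big[Num.max/0]_(j <- s) `|g j|.

Definition Dback eps g j : R := (g j - g (j - 1)) / eps.

Definition D3back eps g j : R :=
  (Dback eps g j - 2 * Dback eps g (j - 1) + Dback eps g (j - 2)) / eps ^+ 2.

(* The next-nearest-neighbour term s_j of the atomistic chain; the first and
   last free atoms lack the neighbour lying outside of the chain. *)
Definition nnn_term (M : nat) (v : lvec R M) j : R :=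
  if j == - M%:Z + 1 then - entry v (j + 2) + entry v j
  else if j == M%:Z - 1 then entry v j - entry v (j - 2)
  else - entry v (j + 2) + 2 * entry v j - entry v (j - 2).

(* Meaningful for -M+1 <= j <= M-1. *)
Definition L_atom phiF phi2F eps (M : nat) (v : lvec R M) j : R :=
  phiF * ((- entry v (j + 1) + 2 * entry v j - entry v (j - 1)) / eps ^+ 2)
  + phi2F * (nnn_term v j / eps ^+ 2).

(* Meaningful for -N+1 <= j <= N-1; the first branch is the atomistic region
   {-K, ..., K}, the second one the continuum region. *)
Definition L_qcf phiF phi2F eps (N K : nat) (v : lvec R N) j : R :=
  if - K%:Z <= j <= K%:Z then
    phiF * ((- entry v (j + 1) + 2 * entry v j - entry v (j - 1)) / eps ^+ 2)
    + phi2F * ((- entry v (j + 2) + 2 * entry v j - entry v (j - 2)) / eps ^+ 2)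
  else
    (phiF + 4 * phi2F)
    * ((- entry v (j + 1) + 2 * entry v j - entry v (j - 1)) / eps ^+ 2).

(* The forces carry the indices -(M-1), ..., M-1. *)
Definition atomistic_solution phiF phi2F eps (M : nat) (f : lvec R M.-1)
    (u : lvec R M) : Prop :=
  [/\ forall j : int, - M%:Z + 1 <= j <= M%:Z - 1 ->
        L_atom phiF phi2F eps u j = entry f j,
      entry u (- M%:Z) = 0
    & entry u M%:Z = 0].

Definition qcf_solution phiF phi2F eps (M N K : nat) (f : lvec R M.-1)
    (ua : lvec R M) (u : lvec R N) : Prop :=
  [/\ forall j : int, - N%:Z + 1 <= j <= N%:Z - 1 ->
        L_qcf phiF phi2F eps K u j = entry f j,
      entry u (- N%:Z) = entry ua (- N%:Z)
    & entry u N%:Z = entry ua N%:Z].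

Definition Ctilde (N K : nat) : seq int :=
  irange (- N%:Z + 2) (- K%:Z + 1) ++ irange (K%:Z + 2) (N%:Z + 1).

End Operators.

(* Main.v *)
Require Import Defs.
From HB Require Import structures.
From mathcomp Require Import all_boot all_order all_algebra.
From mathcomp Require Import reals.
From mathcomp Require Import zify ring lra.

Set Implicit Arguments.
Unset Strict Implicit.
Unset Printing Implicit Defensive.

Import Order.TTheory GRing.Theory Num.Theory.

Local Open Scope ring_scope.

(** Let e be the error and d its backward difference. Up to sign, both
operators are divergences of a flux of d, so each equation says that a flux is constant:
- next-nearest-neighbour interaction carries the flux
  (phiF + 2 phi2F) d_j + phi2F (d_(j+1) + d_(j-1)), which is therefore constant
  over the atomistic region, because the force-based equations are exact there;
- the local interaction carries the flux (phiF + 4 phi2F) d_j, and in each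
  continuum component it is constant up to the truncation error, which is
  itself a difference: phi2F times the increment of eps^3 D^3 u.

Write c = phiF + 4 phi2F > 0. If d is maximal inside the atomistic region, then
c * max d is at most the constant flux there, as phi2F < 0. If d is maximal in
a continuum component, then d at the interface is close to the maximum, and the
atomistic flux equation at the interface gives the same bound with an error
term. The minimum is bounded from below in the same way, with the same
constant, so the unknown flux cancels in max d - min d
([coupled_gradient_osc]); the constants combine to 1 / (phiF + 8 phi2F) through
(phiF + 2 phi2F)(phiF + 8 phi2F) <= c^2. As e vanishes at both ends, d has mean
zero, so |d| is bounded by its oscillation ([qcf_stability]).

With zero data the same estimate makes the homogeneous force-based problem
trivial. For the full chain, the truncated second-neighbour terms next to the
ends amount to an even reflection of v across the end atoms, after which the
flux is constant on the whole chain and the maximum principle applies again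
([atomistic_kernel]). Existence follows since an injective endomorphism of a
finite-dimensional space is surjective ([dirichlet_well_posed]). *)

(** * Integer intervals and backward differences *)

Lemma int_interval_ind (lo hi : int) (P : int -> Prop) :
  P lo -> (forall j, lo <= j < hi -> P j -> P (j + 1)) ->
  forall j, lo <= j <= hi -> P j.
Proof.
move=> P0 PS j /andP[lej jle].
have -> : j = lo + `|j - lo|%N%:Z by lia.
have : lo + `|j - lo|%N%:Z <= hi by lia.
elim: `|j - lo|%N => [|n IHn] len; first by rewrite addr0.
rewrite (_ : lo + n.+1%:Z = lo + n%:Z + 1); last by lia.
by apply: PS; [lia | apply: IHn; lia].
Qed.

Section LatticeFunctions.
Variable R : realFieldType.
Implicit Types (v w d e T : int -> R) (t : R) (lo hi p q i j : int) (g c m : R).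

Definition bdiff v j : R := v j - v (j - 1).

Lemma eq_on_interval lo hi w :
  (forall j, lo <= j < hi -> w (j + 1) = w j) ->
  forall j, lo <= j <= hi -> w j = w lo.
Proof. by move=> wS; apply: int_interval_ind => // j /wS ->. Qed.

Lemma interval_max lo hi w : lo <= hi ->
  exists2 p, lo <= p <= hi & forall j, lo <= j <= hi -> w j <= w p.
Proof.
move=> lohi.
suff H : forall k, lo <= k <= hi ->
  exists2 p, lo <= p <= k & forall j, lo <= j <= k -> w j <= w p.
  by apply: H; lia.
apply: int_interval_ind => [|k hk [p hp maxp]].
  by exists lo => [|j hj]; [lia | rewrite (_ : j = lo) //; lia].
have [le_pk|lt_kp] := leP (w p) (w (k + 1)).
  exists (k + 1) => [|j hj]; first by lia.
  have [->//|nej] := eqVneq j (k + 1).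
  by apply: le_trans le_pk; apply: maxp; lia.
exists p => [|j hj]; first by lia.
have [->|nej] := eqVneq j (k + 1); first exact: ltW.
by apply: maxp; lia.
Qed.

(** The mean of the differences of a function with equal end values is zero, so
an upper bound for them cannot be negative. *)
Lemma bdiff_ub_ge0 lo hi v m : lo < hi -> v lo = v hi ->
  (forall j, lo + 1 <= j <= hi -> bdiff v j <= m) -> 0 <= m.
Proof.
move=> lohi vE dm; have [//|m_lt0] := leP 0 m.
have step j : lo <= j < hi -> v (j + 1) <= v j + m.
  by move=> hj; have := dm (j + 1) ltac:(lia); rewrite /bdiff addrK; lra.
suff H : forall j, lo + 1 <= j <= hi -> v j < v lo.
  by have := H hi ltac:(lia); rewrite vE ltxx.
apply: int_interval_ind => [|j hj IHj].
  by have := step lo ltac:(lia); lra.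
by have := step j ltac:(lia); lra.
Qed.

Lemma bdiff0_const lo hi v :
  (forall j, lo + 1 <= j <= hi -> bdiff v j = 0) ->
  forall j, lo <= j <= hi -> v j = v lo.
Proof.
move=> d0; apply: eq_on_interval => j hj.
by have := d0 (j + 1) ltac:(lia); rewrite /bdiff addrK; lra.
Qed.

(** The even reflection across the end atoms supplies the neighbours which the
first and last free atoms lack: v_(-M-1) = v_(-M+1) turns the full
second-neighbour term at -M+1 into the truncated one. *)
Definition reflect_ext (M : nat) v j : R :=
  if j < - M%:Z then v (- M%:Z - M%:Z - j)
  else if M%:Z < j then v (M%:Z + M%:Z - j) else v j.

Lemma reflect_ext_in (M : nat) v j :
  - M%:Z <= j <= M%:Z -> reflect_ext M v j = v j.
Proof. by move=> hj; rewrite /reflect_ext !ifF //; lia. Qed.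

(** * Fluxes and the maximum principle *)

Variables phiF phi2F : R.

(** The stress at bond j when the bonds have strains d: minus its divergence is
the next-nearest-neighbour operator ([nnn_op_flux]). *)
Definition flux d j : R :=
  (phiF + 2 * phi2F) * d j + phi2F * (d (j + 1) + d (j - 1)).

(** Taking functions on all the integers makes the flux identity hold at every
bond; the scaling by eps^-2 is left to the operators on chains. *)
Definition nnn_op v j : R :=
  phiF * (- v (j + 1) + 2 * v j - v (j - 1))
  + phi2F * (- v (j + 2) + 2 * v j - v (j - 2)).

Definition cauchy_born_op v j : R :=
  (phiF + 4 * phi2F) * (- v (j + 1) + 2 * v j - v (j - 1)).

Lemma nnn_op_flux v j : nnn_op v j = flux (bdiff v) j - flux (bdiff v) (j + 1).
Proof.
rewrite /nnn_op /flux /bdiff.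
rewrite (_ : j + 1 + 1 = j + 2); last by lia.
rewrite (_ : j + 2 - 1 = j + 1); last by lia.
rewrite (_ : j - 1 - 1 = j - 2); last by lia.
rewrite !addrK; ring.
Qed.

Lemma fluxN d j : flux (fun i => - d i) j = - flux d j.
Proof. rewrite /flux; ring. Qed.

Hypotheses (phi2F_lt0 : phi2F < 0) (stab : 0 < phiF + 8 * phi2F).

(** The maximum principle: phi2F being negative, raising the neighbouring
strains to the maximal one lowers the flux. *)
Lemma flux_ge_max d j m : d j = m -> d (j + 1) <= m -> d (j - 1) <= m ->
  (phiF + 4 * phi2F) * m <= flux d j.
Proof.
rewrite /flux => -> dp dm.
have := ler_wnM2l (ltW phi2F_lt0) dp; have := ler_wnM2l (ltW phi2F_lt0) dm; lra.
Qed.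

Lemma local_stiffness_gt0 : 0 < phiF + 4 * phi2F.
Proof. by move: (phi2F_lt0) (stab) => ? ?; lra. Qed.

(** The core [p, q] is the atomistic region, extended by the bonds that touch
it; outside of it only the closeness of d to its interface value is known. The
constant flux is still unknown here, and is left in the bound so that it
cancels against the one obtained for - d. *)
Lemma coupled_gradient_ub lo p q hi d c g :
  lo < p -> p <= q -> q < hi ->
  (forall j, p <= j <= q -> flux d j = c) ->
  (forall j, lo <= j <= p -> (phiF + 4 * phi2F) * `|d j - d p| <= g) ->
  (forall j, q <= j <= hi -> (phiF + 4 * phi2F) * `|d j - d q| <= g) ->
  forall j, lo <= j <= hi ->
  (phiF + 4 * phi2F) ^+ 2 * d j
  <= (phiF + 4 * phi2F) * c + (phiF + 2 * phi2F) * g.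
Proof.
move: (phi2F_lt0) (stab) => phi2F_neg st.
move=> lop pq qhi fluxE gl gr j hj.
have [m hm maxm] : exists2 m : int, lo <= m <= hi &
    forall j, lo <= j <= hi -> d j <= d m.
  by apply: interval_max; lia.
have cgt0 := local_stiffness_gt0.
have g0 : 0 <= g by have := gl p ltac:(lia); rewrite subrr normr0 mulr0.
suff H : (phiF + 4 * phi2F) ^+ 2 * d m
         <= (phiF + 4 * phi2F) * c + (phiF + 2 * phi2F) * g.
  by apply: le_trans H; rewrite ler_wpM2l ?maxm // exprn_ge0 // ltW.
(* The flux at bond i bounds d i by c and the maximum; g then transfers the
   bound from d i to the maximum itself. *)
have interface i : p <= i <= q -> (phiF + 4 * phi2F) * (d m - d i) <= g ->
    (phiF + 4 * phi2F) ^+ 2 * d m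
    <= (phiF + 4 * phi2F) * c + (phiF + 2 * phi2F) * g.
  move=> hi1 dg; have := fluxE i hi1; rewrite /flux => fE.
  have d1 := maxm (i + 1) ltac:(lia); have d2 := maxm (i - 1) ltac:(lia).
  have coef_ge0 : 0 <= phiF + 2 * phi2F by lra.
  have H1 := ler_wpM2l coef_ge0 dg.
  have H2 : (phiF + 2 * phi2F) * d i <= c - 2 * phi2F * d m.
    have := ler_wnM2l (ltW phi2F_lt0) d1.
    have := ler_wnM2l (ltW phi2F_lt0) d2; lra.
  have H3 := ler_wpM2l (ltW cgt0) H2.
  by rewrite expr2; lra.
have [mp|pm] := leP m p.
  apply: (interface p); first by lia.
  by apply: le_trans (gl m ltac:(lia)); rewrite ler_wpM2l ?ler_norm // ltW.
have [qm|mq] := leP q m.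
  apply: (interface q); first by lia.
  by apply: le_trans (gr m ltac:(lia)); rewrite ler_wpM2l ?ler_norm // ltW.
by apply: (interface m); [lia | rewrite subrr mulr0].
Qed.

(** Adding the upper bounds for d and for - d eliminates the flux constant, and
leaves the factor 2 (phiF + 2 phi2F) / (phiF + 4 phi2F)^2, which is at most
2 / (phiF + 8 phi2F). *)
Lemma coupled_gradient_osc lo p q hi d c g :
  lo < p -> p <= q -> q < hi ->
  (forall j, p <= j <= q -> flux d j = c) ->
  (forall j, lo <= j <= p -> (phiF + 4 * phi2F) * `|d j - d p| <= g) ->
  (forall j, q <= j <= hi -> (phiF + 4 * phi2F) * `|d j - d q| <= g) ->
  forall i j, lo <= i <= hi -> lo <= j <= hi ->
  d i - d j <= 2 * g / (phiF + 8 * phi2F).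
Proof.
move: (phi2F_lt0) (stab) => phi2F_neg st.
move=> lop pq qhi fluxE gl gr i j hi1 hj.
have cgt0 := local_stiffness_gt0.
have g0 : 0 <= g by have := gl p ltac:(lia); rewrite subrr normr0 mulr0.
have ubi := coupled_gradient_ub lop pq qhi fluxE gl gr hi1.
have ubj : (phiF + 4 * phi2F) ^+ 2 * - d j
           <= (phiF + 4 * phi2F) * - c + (phiF + 2 * phi2F) * g.
  apply: (@coupled_gradient_ub lo p q hi (fun i => - d i)) => // l hl.
  - by rewrite fluxN fluxE.
  - by rewrite -opprD normrN gl.
  - by rewrite -opprD normrN gr.
have osc : (phiF + 4 * phi2F) ^+ 2 * (d i - d j) <= 2 * g * (phiF + 2 * phi2F).
  by rewrite mulrBr; lra.
rewrite ler_pdivlMr //.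
have csq : 0 < (phiF + 4 * phi2F) ^+ 2 by rewrite exprn_gt0.
rewrite -(ler_pM2l csq) mulrA.
apply: le_trans (ler_wpM2r (ltW stab) osc) _.
have phiF_ge0 : 0 <= phiF by lra.
rewrite (_ : (phiF + 4 * phi2F) ^+ 2 * (2 * g)
             = 2 * g * (phiF + 2 * phi2F) * (phiF + 8 * phi2F)
               - 4 * (g * (phiF * phi2F))).
  by have := mulr_ge0_le0 g0 (mulr_ge0_le0 phiF_ge0 (ltW phi2F_neg)); lra.
by ring.
Qed.

(** Stability of the force-based operator in the maximum norm of strains for
right-hand sides that vanish in the atomistic region and are in divergence form
in the continuum: this is the form of the truncation error, and only the size
of T, not that of its differences, enters the bound. *)
Lemma qcf_stability (N K : nat) e T t :
  (K + 2 <= N)%N -> e (- N%:Z) = 0 -> e N%:Z = 0 ->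
  (forall j, - N%:Z + 1 <= j <= N%:Z - 1 ->
     (if - K%:Z <= j <= K%:Z then nnn_op e j else cauchy_born_op e j)
     = (if - K%:Z <= j <= K%:Z then 0 else phi2F * (T (j + 1) - T j))) ->
  (forall j, (- N%:Z + 1 <= j <= - K%:Z) || (K%:Z + 1 <= j <= N%:Z) ->
     `|T j| <= t) ->
  forall j, - N%:Z + 1 <= j <= N%:Z ->
  `|bdiff e j| <= 4 * (`|phi2F| * t) / (phiF + 8 * phi2F).
Proof.
move: (phi2F_lt0) (stab) => phi2F_neg st.
move=> hKN el er eqE Tt.
have fluxE j : - K%:Z <= j <= K%:Z + 1 ->
    flux (bdiff e) j = flux (bdiff e) (- K%:Z).
  apply: eq_on_interval => {}j hj; have := eqE j ltac:(lia).
  by rewrite ifT ?ifT ?nnn_op_flux; [lra | lia..].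
(* The local flux corrected by the truncation error; it is constant on each
   continuum component. *)
pose z j := (phiF + 4 * phi2F) * bdiff e j + phi2F * T j.
have zS j : - N%:Z + 1 <= j <= N%:Z - 1 -> ~~ (- K%:Z <= j <= K%:Z) ->
    z (j + 1) = z j.
  move=> hj /negbTE jC; have := eqE j hj.
  by rewrite jC /z /bdiff /cauchy_born_op addrK; lra.
have norm_phi2F : `|phi2F| = - phi2F by rewrite ltr0_norm.
have zosc i j : z i = z j -> `|T i| <= t -> `|T j| <= t ->
    (phiF + 4 * phi2F) * `|bdiff e i - bdiff e j| <= 2 * (`|phi2F| * t).
  move=> zE Ti Tj.
  have cgt0 := local_stiffness_gt0.
  rewrite -{1}(gtr0_norm cgt0) -normrM.
  have -> : (phiF + 4 * phi2F) * (bdiff e i - bdiff e j) = phi2F * (T j - T i).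
    by move: zE; rewrite /z; lra.
  rewrite normrM mulrCA ler_wpM2l //.
  by apply: le_trans (ler_normB _ _) _; lra.
have gl j : - N%:Z + 1 <= j <= - K%:Z ->
    (phiF + 4 * phi2F) * `|bdiff e j - bdiff e (- K%:Z)| <= 2 * (`|phi2F| * t).
  move=> hj; have zc := @eq_on_interval (- N%:Z + 1) (- K%:Z) z.
  apply: zosc; [|by apply: Tt; lia..].
  by rewrite !zc //; first [lia | move=> i hi; apply: zS; lia].
have gr j : K%:Z + 1 <= j <= N%:Z ->
    (phiF + 4 * phi2F) * `|bdiff e j - bdiff e (K%:Z + 1)|
    <= 2 * (`|phi2F| * t).
  move=> hj; have zc := @eq_on_interval (K%:Z + 1) N%:Z z.
  apply: zosc; [|by apply: Tt; lia..].
  by rewrite !zc //; first [lia | move=> i hi; apply: zS; lia].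
have osc : forall i j, _ -> _ -> _ :=
  @coupled_gradient_osc (- N%:Z + 1) (- K%:Z) (K%:Z + 1) N%:Z (bdiff e) _ _
  ltac:(lia) ltac:(lia) ltac:(lia) fluxE gl gr.
move=> j hj; rewrite (_ : 4 * _ = 2 * (2 * (`|phi2F| * t))); last by ring.
set B := _ / _ in osc *.
rewrite ler_norml -subr_ge0; apply/andP; split.
  rewrite opprK.
  apply: (@bdiff_ub_ge0 (- N%:Z) N%:Z e); [by lia | by rewrite el er |].
  by move=> i hi; have := osc i j hi hj; lra.
rewrite -subr_ge0.
apply: (@bdiff_ub_ge0 (- N%:Z) N%:Z (fun i => - e i));
  [by lia | by rewrite el er |].
move=> i hi; have := osc j i hj hi; rewrite /bdiff; lra.
Qed.

(** * Uniqueness for the full chain *)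

(** By reflection, the strain beyond an end of the chain is minus the strain at
the last bond. When the last bond carries the maximum, which is nonnegative,
the strain beyond it does not exceed the maximum either. *)
Lemma atomistic_gradient_ub (M : nat) v c :
  (0 < M)%N -> v (- M%:Z) = 0 -> v M%:Z = 0 ->
  v (- M%:Z - 1) = v (- M%:Z + 1) -> v (M%:Z + 1) = v (M%:Z - 1) ->
  (forall j, - M%:Z + 1 <= j <= M%:Z -> flux (bdiff v) j = c) ->
  forall j, - M%:Z + 1 <= j <= M%:Z -> (phiF + 4 * phi2F) * bdiff v j <= c.
Proof.
move: (phi2F_lt0) (stab) => phi2F_neg st.
move=> M0 vl vr gl gr fluxE j hj.
have [m hm maxm] := @interval_max (- M%:Z + 1) M%:Z (bdiff v) ltac:(lia).
have cgt0 := local_stiffness_gt0.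
apply: le_trans (ler_wpM2l (ltW cgt0) (maxm _ hj)) _.
have m_ge0 : 0 <= bdiff v m.
  by apply: (@bdiff_ub_ge0 (- M%:Z) M%:Z v) => //; [lia | rewrite vl vr].
rewrite -(fluxE m hm); apply: flux_ge_max => //.
  have [mM|neM] := eqVneq m M%:Z; last by apply: maxm; lia.
  by move: m_ge0; rewrite mM /bdiff addrK gr vr; lra.
have [mM|neM] := eqVneq m (- M%:Z + 1); last by apply: maxm; lia.
by move: m_ge0; rewrite mM /bdiff addrK gl vl; lra.
Qed.

(** The constant flux is an upper bound for (phiF + 4 phi2F) times the strains
and, by the same argument for - v, also a lower one. Hence all strains are
equal, and a constant strain of mean zero vanishes. *)
Lemma atomistic_kernel (M : nat) v :
  (0 < M)%N -> v (- M%:Z) = 0 -> v M%:Z = 0 ->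
  v (- M%:Z - 1) = v (- M%:Z + 1) -> v (M%:Z + 1) = v (M%:Z - 1) ->
  (forall j, - M%:Z + 1 <= j <= M%:Z - 1 -> nnn_op v j = 0) ->
  forall j, - M%:Z <= j <= M%:Z -> v j = 0.
Proof.
move: (phi2F_lt0) (stab) => phi2F_neg st.
move=> M0 vl vr gl gr v0.
have fluxE : forall j, - M%:Z + 1 <= j <= M%:Z ->
    flux (bdiff v) j = flux (bdiff v) (- M%:Z + 1).
  apply: eq_on_interval => j hj; have := v0 j ltac:(lia).
  by rewrite nnn_op_flux; lra.
have ub := atomistic_gradient_ub M0 vl vr gl gr fluxE.
have lb j : - M%:Z + 1 <= j <= M%:Z ->
    flux (bdiff v) (- M%:Z + 1) <= (phiF + 4 * phi2F) * bdiff v j.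
  have NE i : bdiff (fun l => - v l) i = - bdiff v i by rewrite /bdiff; ring.
  move=> hj.
  have := @atomistic_gradient_ub M (fun l => - v l)
    (- flux (bdiff v) (- M%:Z + 1)) M0.
  rewrite vl vr gl gr oppr0 => /(_ erefl erefl erefl erefl) H.
  have := H _ j hj; rewrite NE mulrN lerN2; apply => i hi.
  by rewrite -(fluxE i hi) /flux !NE; ring.
have cgt0 := local_stiffness_gt0.
have dE i j : - M%:Z + 1 <= i <= M%:Z -> - M%:Z + 1 <= j <= M%:Z ->
    bdiff v i <= bdiff v j.
  by move=> hi hj; rewrite -(ler_pM2l cgt0) (le_trans (ub _ hi) (lb _ hj)).
move=> j hj; rewrite (@bdiff0_const (- M%:Z) M%:Z v) // => i hi.
apply/le_anti/andP; split.
  rewrite -oppr_ge0.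
  apply: (@bdiff_ub_ge0 (- M%:Z) M%:Z (fun l => - v l));
    [by lia | by rewrite vl vr |].
  by move=> l hl; have := dE i l hi hl; rewrite /bdiff; lra.
apply: (@bdiff_ub_ge0 (- M%:Z) M%:Z v); [by lia | by rewrite vl vr |].
by move=> l hl; exact: dE.
Qed.

End LatticeFunctions.

(** * Well-posedness of Dirichlet problems *)

Lemma linear_surj (R : fieldType) (m : nat) (F : 'rV[R]_m -> 'rV[R]_m) :
  linear F -> (forall v, F v = 0 -> v = 0) -> forall y, exists x, F x = y.
Proof.
move=> Flin ker0 y.
pose L : {linear 'rV[R]_m -> 'rV[R]_m} :=
  HB.pack F (GRing.isLinear.Build _ _ _ _ F Flin).
have Aunit : lin1_mx L \in unitmx.
  rewrite -row_free_unit; apply: inj_row_free => v.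
  by rewrite mul_rV_lin1; apply: ker0.
by exists (y *m invmx (lin1_mx L)); rewrite -[F _](mul_rV_lin1 L) mulmxKV.
Qed.

Section WellPosedness.
Variables (R : realType) (n : nat).
Implicit Types (u v : lvec R n).

Lemma entry_ord v (i : 'I_(n.*2.+1)) : entry v (i%:Z - n%:Z) = v ord0 i.
Proof. by rewrite /entry subrK absz_nat inord_val. Qed.

Lemma entry_inj u v :
  (forall j : int, - n%:Z <= j <= n%:Z -> entry u j = entry v j) -> u = v.
Proof.
move=> uv; apply/rowP => i; rewrite -!entry_ord; apply: uv.
by have := ltn_ord i; lia.
Qed.

Lemma entry_linear (a : R) u v j :
  entry (a *: u + v) j = a * entry u j + entry v j.
Proof. by rewrite /entry !mxE. Qed.

(** The boundary conditions are put in as the first and last rows of a square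
linear system, whose kernel is the solution set of the homogeneous problem. *)
Lemma dirichlet_well_posed (L : lvec R n -> int -> R) :
  (0 < n)%N ->
  (forall a u v j, L (a *: u + v) j = a * L u j + L v j) ->
  (forall v, (forall j : int, - n%:Z + 1 <= j <= n%:Z - 1 -> L v j = 0) ->
     entry v (- n%:Z) = 0 -> entry v n%:Z = 0 -> v = 0) ->
  forall (g : int -> R) (bl br : R), exists u, unique (fun u =>
    [/\ forall j : int, - n%:Z + 1 <= j <= n%:Z - 1 -> L u j = g j,
        entry u (- n%:Z) = bl & entry u n%:Z = br]) u.
Proof.
move=> n_gt0 Llin ker0 g bl br.
pose inner (i : 'I_(n.*2.+1)) := (0 < i < n.*2)%N.
pose F u : lvec R n := \row_i (if inner i then L u (i%:Z - n%:Z) else u ord0 i).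
pose y : lvec R n :=
  \row_i (if inner i then g (i%:Z - n%:Z)
          else if i == 0%N :> nat then bl else br).
have Flin : linear F.
  by move=> a u v; apply/rowP => i; rewrite !mxE; case: ifP; rewrite ?mxE.
have FP (h : int -> R) c d u :
    F u = \row_i (if inner i then h (i%:Z - n%:Z)
                  else if i == 0%N :> nat then c else d) ->
    [/\ forall j : int, - n%:Z + 1 <= j <= n%:Z - 1 -> L u j = h j,
        entry u (- n%:Z) = c & entry u n%:Z = d].
  move=> /rowP Fu; split=> [j hj||].
  - have := Fu (inord (absz (j + n%:Z))).
    have ijE : (inord (absz (j + n%:Z)) : 'I_(n.*2.+1))
               = absz (j + n%:Z) :> nat.
      by rewrite inordK //; lia.
    rewrite !mxE ifT ?ifT /inner ijE; [|lia..].
    by rewrite (_ : _ - _ = j) //; lia.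
  - have := Fu ord0; rewrite !mxE /inner /= => <-.
    by rewrite -entry_ord sub0r.
  - have := Fu ord_max.
    rewrite !mxE /inner /= ltnn andbF double_eq0 gtn_eqF // => <-.
    rewrite -entry_ord /=; congr (entry _ _); lia.
have Fker v : F v = 0 -> v = 0.
  move=> Fv; have [|Lv vl vr] := FP (fun=> 0) 0 0 v; last exact: ker0.
  by rewrite Fv; apply/rowP => i; rewrite !mxE; do 2?case: ifP.
have [u Fu] := linear_surj Flin Fker y.
have [Lu ul ur] := FP g bl br u Fu.
exists u; split=> // v [Lv vl vr].
apply/esym/subr0_eq; rewrite -[v - u]addrC -scaleN1r; apply: ker0 => [j hj||].
- by rewrite Llin Lu // Lv // mulN1r addNr.
- by rewrite entry_linear ul vl mulN1r addNr.
- by rewrite entry_linear ur vr mulN1r addNr.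
Qed.

End WellPosedness.

(** * The atomistic and force-based chains *)

Lemma third_difference (R : realType) (eps : R) (u : int -> R) (j : int) :
  eps != 0 ->
  u (j + 1) - 3 * u j + 3 * u (j - 1) - u (j - 2)
  = eps ^+ 3 * D3back eps u (j + 1).
Proof.
move=> eps_neq0; rewrite /D3back /Dback.
rewrite addrK (_ : j + 1 - 2 = j - 1); last by lia.
rewrite (_ : j - 1 - 1 = j - 2); last by lia.
by field.
Qed.

Section ChainOperators.
Variables (R : realType) (phiF phi2F eps : R).
Hypothesis eps_neq0 : eps != 0.

Lemma L_atom_linear (M : nat) a (u v : lvec R M) j :
  L_atom phiF phi2F eps (a *: u + v) j
  = a * L_atom phiF phi2F eps u j + L_atom phiF phi2F eps v j.
Proof.
rewrite /L_atom /nnn_term !entry_linear.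
case: ifP => _; last case: ifP => _; ring.
Qed.

Lemma L_qcf_linear (N K : nat) a (u v : lvec R N) j :
  L_qcf phiF phi2F eps K (a *: u + v) j
  = a * L_qcf phiF phi2F eps K u j + L_qcf phiF phi2F eps K v j.
Proof. rewrite /L_qcf !entry_linear; case: ifP => _; ring. Qed.

Lemma L_atom_nnn_op (M : nat) (v : lvec R M) (j : int) :
  - M%:Z + 2 <= j <= M%:Z - 2 ->
  nnn_op phiF phi2F (entry v) j = eps ^+ 2 * L_atom phiF phi2F eps v j.
Proof.
move=> hj; rewrite /L_atom /nnn_term /nnn_op !ifF; [|lia..].
by field.
Qed.

Lemma L_atom_reflect (M : nat) (v : lvec R M) (j : int) :
  (1 < M)%N -> - M%:Z + 1 <= j <= M%:Z - 1 ->
  nnn_op phiF phi2F (reflect_ext M (entry v)) j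
  = eps ^+ 2 * L_atom phiF phi2F eps v j.
Proof.
move=> M1 hj.
have inE := @reflect_ext_in R M (entry v).
rewrite /L_atom /nnn_op !(inE (j + 1), inE (j - 1), inE j); [|lia..].
rewrite /nnn_term; case: eqP => [jl|jl].
  rewrite (inE (j + 2)); last by lia.
  rewrite /reflect_ext ifT; last by lia.
  by rewrite (_ : _ - (j - 2) = j); [field | lia].
case: eqP => [jr|jr].
  rewrite (inE (j - 2)); last by lia.
  rewrite /reflect_ext ifF ?ifT; [|lia..].
  by rewrite (_ : _ - (j + 2) = j); [field | lia].
by rewrite !inE; [field | lia..].
Qed.

Lemma L_qcf_op (N K : nat) (v : lvec R N) (j : int) :
  (if - K%:Z <= j <= K%:Z then nnn_op phiF phi2F (entry v) j
   else cauchy_born_op phiF phi2F (entry v) j)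
  = eps ^+ 2 * L_qcf phiF phi2F eps K v j.
Proof. by rewrite /L_qcf /nnn_op /cauchy_born_op; case: ifP => _; field. Qed.

Hypotheses (phi2F_lt0 : phi2F < 0) (stab : 0 < phiF + 8 * phi2F).

Lemma atomistic_well_posed (M : nat) (f : lvec R M.-1) : (1 < M)%N ->
  exists ua : lvec R M, unique (atomistic_solution phiF phi2F eps f) ua.
Proof.
move=> M1; apply: (@dirichlet_well_posed R M (L_atom phiF phi2F eps (M := M))
  _ _ _ (entry f) 0 0); first by lia.
  exact: L_atom_linear.
move=> v Lv vl vr; apply: entry_inj => j hj.
have inE := @reflect_ext_in R M (entry v).
rewrite -inE // [RHS]/entry mxE.
apply: (atomistic_kernel phi2F_lt0 stab _ _ _ _ _ _ hj).
- by lia.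
- by rewrite inE //; lia.
- by rewrite inE //; lia.
- rewrite (inE (- M%:Z + 1)); last by lia.
  by rewrite /reflect_ext ifT; [congr entry; lia | lia].
- rewrite (inE (M%:Z - 1)); last by lia.
  by rewrite /reflect_ext ifF ?ifT; [congr entry; lia | lia..].
- by move=> i hi; rewrite L_atom_reflect // Lv // mulr0.
Qed.

(** The homogeneous problem is the case T = 0 of [qcf_stability]. *)
Lemma qcf_well_posed (M N K : nat) (f : lvec R M.-1) (ua : lvec R M) :
  (K + 2 <= N)%N ->
  exists uq : lvec R N, unique (qcf_solution phiF phi2F eps K f ua) uq.
Proof.
move=> hKN; apply: (@dirichlet_well_posed R N (L_qcf phiF phi2F eps K (N := N))
  _ _ _ (entry f) (entry ua (- N%:Z)) (entry ua N%:Z)); first by lia.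
  exact: L_qcf_linear.
move=> v Lv vl vr; apply: entry_inj => j hj; rewrite [RHS]/entry mxE.
rewrite -vl; apply: (@bdiff0_const _ (- N%:Z) N%:Z) => // i hi.
apply/eqP; rewrite -normr_le0.
have := qcf_stability phi2F_lt0 stab (T := fun=> 0) (t := 0) hKN vl vr.
rewrite !mulr0 mul0r; apply=> // l hl.
  by rewrite L_qcf_op Lv // subrr !mulr0 if_same.
by rewrite normr0.
Qed.

End ChainOperators.

Theorem theorem6p1 (R : realType) (phiF phi2F : R) (M N K : nat)
    (f : lvec R M.-1)
    (hK0 : (0 < K)%N) (hKN : (K < N - 1)%N) (hNM : (N < M)%N)
    (hphiF : 0 < phiF) (hphi2F : phi2F < 0) (hstab : 0 < phiF + 8 * phi2F) :
  let eps : R := 1 / N%:R in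
  exists2 ua : lvec R M, unique (atomistic_solution phiF phi2F eps f) ua &
  exists2 uq : lvec R N, unique (qcf_solution phiF phi2F eps K f ua) uq &
    linf_norm (irange (- N%:Z + 1) N%:Z)
      (Dback eps (fun j : int => entry ua j - entry uq j))
    <= 4 * eps ^+ 2 *
       (`|phi2F| * linf_norm (Ctilde N K) (D3back eps (entry ua))
        / (phiF + 8 * phi2F)).
Proof.
move=> eps.
have eps_gt0 : 0 < eps by rewrite divr_gt0 // ltr0n; lia.
have eps_neq0 : eps != 0 by rewrite gt_eqF.
have [ua ua_uniq] :=
  atomistic_well_posed eps_neq0 hphi2F hstab f (M := M) ltac:(lia).
have [uq uq_uniq] :=
  qcf_well_posed eps_neq0 hphi2F hstab f ua (K := K) (N := N) ltac:(lia).
exists ua => //; exists uq => //.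
have [[La _ _] _] := ua_uniq; have [[Lq ql qr] _] := uq_uniq.
set X := linf_norm (Ctilde N K) _.
(* The fourth difference, by which the two operators differ in the continuum,
   is the increment of T; the shift by one makes T j the third difference on
   the stencil j - 2, ..., j + 1. *)
pose T (j : int) := eps ^+ 3 * D3back eps (entry ua) (j + 1).
have X_ge0 : 0 <= X by exact: bigmax_ge_id.
have rhs_ge0 : 0 <= 4 * eps ^+ 2 * (`|phi2F| * X / (phiF + 8 * phi2F)).
  apply: mulr_ge0; first by rewrite mulr_ge0 // exprn_ge0 // ltW.
  by rewrite mulr_ge0 ?mulr_ge0 // invr_ge0 ltW.
rewrite /linf_norm big_seq; apply: bigmax_le => // j; rewrite mem_irange => hj.
rewrite /Dback normrM normfV (gtr0_norm eps_gt0) ler_pdivrMr //.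
rewrite (_ : _ * eps
    = 4 * (`|phi2F| * (eps ^+ 3 * X)) / (phiF + 8 * phi2F)); last first.
  by field; rewrite gt_eqF.
apply: (qcf_stability hphi2F hstab (N := N) (K := K) (T := T)
  (e := fun j => entry ua j - entry uq j)) hj; first by lia.
- by rewrite ql subrr.
- by rewrite qr subrr.
- move=> i hi.
  have Ra : nnn_op phiF phi2F (entry ua) i = eps ^+ 2 * entry f i.
    by rewrite (L_atom_nnn_op _ _ eps_neq0) ?La //; lia.
  have := L_qcf_op phiF phi2F eps_neq0 K uq i; rewrite Lq // -Ra.
  rewrite /T -!(third_difference _ _ eps_neq0).
  rewrite addrK (_ : i + 1 + 1 = i + 2); last by lia.
  rewrite (_ : i + 1 - 2 = i - 1); last by lia.
  by case: ifP => _; rewrite /nnn_op /cauchy_born_op; lra.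
- move=> i hi; rewrite /T normrM gtr0_norm ?exprn_gt0 //.
  rewrite ler_wpM2l ?exprn_ge0 ?(ltW eps_gt0) //.
  rewrite /X /linf_norm; apply: (bigmax_sup_seq _ (i + 1)) => //.
  by rewrite mem_cat !mem_irange; lia.
Qed.
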